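(* Let $r\ge 2$ be an integer and let $\lambda>0$ satisfy $\lambda<(r-1)^{r-1}/(r-2)^r$ (for $r=2$ the right-hand side is interpreted as $+\infty$). Let $x$ be the unique positive solution of $x=1/(1+\lambda x^{r-1})$. Then the partition function $Z(\lambda,G)$ corresponding to independent sets satisfies $$\lim_{g\to\infty}\ \sup_{G\in\mathcal{G}(n,g,r)}\left|\frac{\log Z(\lambda,G)}{n}-\log\Big(x^{-\frac r2}(2-x)^{-\frac{r-2}{2}}\Big)\right|=0,$$ where the supremum is over all $n\ge1$ and all $G\in\mathcal{G}(n,g,r)$. When $\lambda=1$ and $r=2,3,4,5$ (all of which satisfy the hypothesis), the corresponding limits for $n^{-1}\log|\mathcal{I}(G)|$ are $\log c_2,\log c_3,\log c_4,\log c_5$ with $c_2\approx1.618$, $c_3\approx1.545$, $c_4\approx1.494$, $c_5\approx1.453$ respectively, each approximation being accurate to within $10^{-3}$.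
   Context: Graphs are finite and simple. $\mathcal{I}(G)$ is the set of independent sets of $G$ (including the empty set) and $Z(\lambda,G)=\sum_{I\in\mathcal{I}(G)}\lambda^{|I|}$, so $Z(1,G)=|\mathcal{I}(G)|$. The girth of a graph is the length of a shortest cycle. $\mathcal{G}(n,g,r)$ is the set of all $r$-regular graphs with $n$ nodes and girth at least $g$. *)

(* Defs.v *)
From HB Require Import structures.
From mathcomp Require Import all_boot all_order all_algebra.
From mathcomp Require Import all_classical all_reals all_analysis.
Import numFieldNormedType.Exports.

Set Implicit Arguments.
Unset Strict Implicit.
Unset Printing Implicit Defensive.
Import Order.TTheory GRing.Theory Num.Theory.

Local Open Scope classical_set_scope.
Local Open Scope ring_scope.

Record sgraph := SGraph {
  vertex :> finType;
  adj : rel vertex;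
  adj_sym : symmetric adj;
  adj_irr : irreflexive adj }.

Definition indep_sets (G : sgraph) : {set {set G}} :=
  [set I : {set G} | [forall u in I, forall v in I, ~~ adj u v]]%SET.

Definition partition_function (R : realType) (lam : R) (G : sgraph) : R :=
  \sum_(I in indep_sets G) lam ^+ #|I|.

(* [ucycle] alone accepts the empty sequence and the back-and-forth traversal *)
(* of a single edge, hence the bound on the size.                             *)
Definition graph_cycle (G : sgraph) (c : seq G) : Prop :=
  (3 <= size c)%N /\ ucycle (@adj G) c.

(* The girth of an acyclic graph is +oo. *)
Definition girth (R : realType) (G : sgraph) : \bar R :=
  ereal_inf [set ((size c)%:R)%:E | c in @graph_cycle G].

Definition regular (r : nat) (G : sgraph) : Prop :=
  forall v : G, #|[pred w | adj v w]| = r.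

Definition regular_girth (R : realType) (n g r : nat) (G : sgraph) : Prop :=
  [/\ #|G| = n, regular r G & (g%:R%:E <= girth R G)%E].

(* The supremum is -oo when no graph qualifies, so convergence of this        *)
(* quantity to 0 entails that r-regular graphs of arbitrarily large girth     *)
(* exist.                                                                     *)
Definition sup_deviation (R : realType) (f : sgraph -> R) (l : R) (g r : nat) :
    \bar R :=
  ereal_sup [set y | exists n (G : sgraph),
    [/\ (1 <= n)%N, regular_girth R n g r G & y = `| f G / n%:R - l |%:E]].

Definition lambda_crit (R : realType) (r : nat) : \bar R :=
  if r == 2%N then +oo%E
  else ((r.-1)%:R ^+ r.-1 / (r.-2)%:R ^+ r)%:E.

Definition pos_fixpoint (R : realType) (r : nat) (lam x : R) : Prop :=
  0 < x /\ x = 1 / (1 + lam * x ^+ r.-1).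

Definition growth_const (R : realType) (r : nat) (x : R) : R :=
  (x `^ (- (r%:R / 2))) * ((2 - x) `^ (- ((r%:R - 2) / 2))).

(* Main.v *)
Require Import Defs.
From HB Require Import structures.
From mathcomp Require Import all_boot all_order all_algebra all_fingroup.
From mathcomp Require Import all_classical all_reals all_analysis.
From mathcomp Require Import ring lra.
Import numFieldNormedType.Exports.
Import Order.TTheory GRing.Theory Num.Theory.
Local Open Scope classical_set_scope.
Local Open Scope ring_scope.

(** Write [n = #|G|].  Since [partition_function 0 G = 1], the normalized free
    energy [ln Z(lam) / n] is recovered from its derivative in the fugacity
    [t], and the derivative is local:

      [Z'(t) / Z(t) = \sum_v Z(G - N[v]) / Z(G)].

    Put [q = Z(G - N[v]) / Z(G - v)], so that the summand is [q / (1 + t q)],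
    and delete the [r] neighbours of [v] one after the other: [q] becomes a
    product of [r] cavity ratios, each of the form [Z(S - u) / Z(S)].  The same
    deletion argument shows that a cavity ratio is the image under
    [y |-> 1 / (1 + t y_1 ... y_(r-1))] of the cavity ratios of the children
    of [u].  As long as the exploration has not closed a cycle these children
    behave as in a tree, so girth at least [k + 3] allows the recursion to be
    unfolded [k] times ([cavity_marginal]); starting from the trivial bounds 0
    and 1, it encloses every cavity ratio between the iterates [lower k] and
    [upper k] of the scalar map [cavity_map].

    Below the critical fugacity these iterates merge geometrically, uniformly
    for [t] in [[0, lam]] ([cavity_gap]).  With [d = r - 1] and [f] the cavity
    map, the map [f \o f] has derivative [d^2 (1 - f x) (1 - f (f x))] in the
    coordinate [ln x], and the weighted arithmetic-geometric mean inequality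
    bounds [d^2 (1 - y) (1 - f y)] away from 1 exactly when [lam] is
    subcritical.

    The fixed point [x] of [f] at fugacity [t] satisfies
    [t = (1 - x) / x ^ r], so [x] is a better parameter than [t].  Along the
    curve [y |-> fugacity y], for [y] from [x] to 1, the logarithm of the
    growth constant has exactly the derivative that the cavity recursion
    predicts on the infinite tree, while both it and the free energy vanish at
    [y = 1].  A comparison of derivatives then bounds their difference by a
    constant times [rate ^+ j] ([free_energy_deviation]).

    The supremum has to be taken over a nonempty family, hence the last
    ingredient: for every [r] and [g] there is an [r]-regular graph of girth at
    least [g].  It is a Cayley graph of the permutation group of the words of
    length at most [g + 1] over [r] letters, the generator [i] adding or
    removing the letter [i] in front of a word ([cayley_regular],
    [cayley_girth]). *)

Set Implicit Arguments.
Unset Strict Implicit.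
Unset Printing Implicit Defensive.

(** * Nonbacktracking walks and girth *)

Section Walks.
Variable G : sgraph.
Implicit Types (x y z : G) (s : seq G).

(** The walk [x, y, s]: being recursive on the tail, it exposes the first edge,
    along which the cavity recursion proceeds. *)
Fixpoint nonbacktracking x y s : bool :=
  adj x y && (if s is z :: s' then (z != x) && nonbacktracking y z s' else true).

Lemma nonbacktracking_path x y s :
  nonbacktracking x y s -> path (@adj G) x (y :: s).
Proof.
elim: s x y => [|z s IH] x y //=.
by case/andP=> -> /andP[_ /IH].
Qed.

Lemma girth_cycle (R : realType) g (c : seq G) :
  (g%:R%:E <= girth R G)%E -> graph_cycle c -> (g <= size c)%N.
Proof.
move=> gG cc; rewrite -(@ler_nat R) -lee_fin; apply: le_trans gG _.
by apply: ereal_inf_lbound; exists c.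
Qed.

(** A repeated vertex would close a cycle: at the first return to [x], the
    portion of the walk in between has no repetition by induction, and it has
    at least three vertices because the walk neither stays in place nor
    backtracks. *)
Lemma nonbacktracking_uniq (R : realType) g x y s :
  (g%:R%:E <= girth R G)%E -> nonbacktracking x y s ->
  ((size s).+2 <= g)%N -> uniq (x :: y :: s).
Proof.
move=> gG; elim: s x y => [|z s IH] x y nb sg.
  rewrite /= inE andbT; move: nb; rewrite /= andbT => axy.
  by apply/eqP=> xy; rewrite xy adj_irr in axy.
have pxy := nonbacktracking_path nb.
case/andP: nb => axy /andP[zx nb].
have uyz : uniq (y :: z :: s) by apply: IH => //; apply: ltnW.
rewrite cons_uniq uyz andbT; apply/negP => xin.
have [p1 [p2 E]] : exists p1 p2, y :: z :: s = p1 ++ x :: p2.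
  by case/splitPr: xin => p1 p2; exists p1, p2.
have xp1 : x \notin p1.
  apply/negP=> xp1; move: uyz; rewrite E cat_uniq => /and3P[_ /hasPn/(_ x)].
  by rewrite inE eqxx xp1 => /(_ isT).
have cy : graph_cycle (x :: p1).
  split.
    case: p1 E xp1 => [|a [|b p1]] //= [].
      by move=> yx; rewrite yx adj_irr in axy.
    by move=> _ zE; rewrite zE eqxx in zx.
  apply/andP; split.
    move: pxy; rewrite E cat_path /= => /andP[p1p /andP[lx _]].
    by rewrite /= rcons_path p1p.
  by rewrite cons_uniq xp1 /=; move: uyz; rewrite E cat_uniq => /andP[].
have := girth_cycle gG cy; move/(leq_trans sg).
have -> : (size (z :: s)).+2 = (size (y :: z :: s)).+1 by [].
by rewrite E size_cat /= addnS ltnNge ltnS leq_addr.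
Qed.

End Walks.

(** * Partition functions of induced subgraphs *)

Section SubsetPartition.
Variables (R : realType) (G : sgraph).
Implicit Types (S I : {set G}) (u v : G) (t : R).

Definition nbrs v : {set G} := [set w | adj v w]%SET.

Definition Zsub t S : R :=
  \sum_(I in indep_sets G | I \subset S) t ^+ #|I|.

Lemma ZsubT t : Zsub t [set: G]%SET = partition_function t G.
Proof. by apply: eq_bigl => I; rewrite finset.subsetT andbT. Qed.

Lemma indep0 : finset.set0 \in indep_sets G.
Proof. by rewrite inE; apply/forall_inP => u; rewrite inE. Qed.

Lemma Zsub_ge1 t S : 0 <= t -> 1 <= Zsub t S.
Proof.
move=> t0; rewrite /Zsub (bigD1 finset.set0) /=; last by rewrite indep0 finset.sub0set.
rewrite cards0 expr0 lerDl; apply: sumr_ge0 => I _; exact: exprn_ge0.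
Qed.

Lemma Zsub_mono t S S' : 0 <= t -> S \subset S' -> Zsub t S <= Zsub t S'.
Proof.
move=> t0 SS'; rewrite /Zsub [leRHS](bigID (fun I => I \subset S)) /=.
rewrite (_ : \sum_(I in _ | _) _ =
  \sum_(i in indep_sets G | (i \subset S') && (i \subset S)) t ^+ #|i|).
  rewrite (eq_bigl (fun i => ((i \in indep_sets G) && (i \subset S')) && (i \subset S))).
    by rewrite lerDl; apply: sumr_ge0 => I _; exact: exprn_ge0.
  by move=> i /=; rewrite andbA.
apply: eq_bigl => I; congr (_ && _).
by case: (boolP (I \subset S)) => IS; rewrite ?andbF // andbT (fintype.subset_trans IS).
Qed.

Lemma indep_setU1 v I : v \notin I ->
  (v |: I \in indep_sets G)%SET = (I \in indep_sets G) && [disjoint I & nbrs v].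
Proof.
move=> vI; rewrite !inE; apply/idP/andP => [/forall_inP h|[/forall_inP h d]].
  split.
    apply/forall_inP => u uI; apply/forall_inP => w wI.
    have /forall_inP := h u (finset.setU1r _ uI); apply; exact: finset.setU1r.
  rewrite disjoint_subset; apply/fintype.subsetP => u uI; rewrite !inE.
  have /forall_inP := h v (finset.setU11 _ _); apply; exact: finset.setU1r.
have nv w : w \in I -> ~~ adj v w.
  by move=> wI; have := disjointFr d wI; rewrite inE => ->.
apply/forall_inP => u /finset.setU1P[->|uI]; apply/forall_inP => w /finset.setU1P[->|wI].
- by rewrite adj_irr.
- exact: nv.
- by rewrite adj_sym; apply: nv.
- by have /forall_inP := h u uI; apply.
Qed.

(** The independent sets through [v] are in bijection, by removal of [v], with
    the independent sets avoiding the closed neighbourhood of [v]. *)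
Lemma sum_indep_mem t S v : v \in S ->
  \sum_(I in indep_sets G | (I \subset S) && (v \in I)) t ^+ (#|I|.-1)
    = Zsub t (S :\ v :\: nbrs v)%SET.
Proof.
move=> vS.
rewrite (reindex_onto (fun I => v |: I)%SET (fun I => I :\ v)%SET) /=; last first.
  by move=> I /andP[_ /andP[_ vI]]; rewrite finset.setD1K.
rewrite /Zsub; apply: congr_big => // I.
  rewrite finset.setU11 andbT finset.subUset finset.sub1set vS /=.
  case: (boolP (v \in I)) => vI.
    have -> : (v |: I)%SET :\ v == I = false.
      by apply/negbTE/eqP => /finset.setP/(_ v); rewrite !inE eqxx vI.
    rewrite !andbF; apply/esym/negbTE/negP => /andP[_ /fintype.subsetP/(_ v vI)].
    by rewrite !inE eqxx !andbF.
  rewrite indep_setU1 // finset.setU1K // eqxx andbT -andbA; congr (_ && _).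
  rewrite finset.subsetD finset.subsetD1 vI andbT andbC; congr (_ && _).
move=> /andP[/andP[_ _] /eqP E].
have vI : v \notin I by rewrite -E !inE eqxx.
by rewrite cardsU1 vI.
Qed.

Lemma Zsub_rec t S v : v \in S ->
  Zsub t S = Zsub t (S :\ v)%SET + t * Zsub t (S :\ v :\: nbrs v)%SET.
Proof.
move=> vS; rewrite -sum_indep_mem // {1}/Zsub (bigID (fun I => v \in I)) /= addrC.
congr (_ + _).
  by apply: eq_bigl => I; rewrite finset.subsetD1 andbA.
rewrite mulr_sumr; apply: congr_big => // I; first by rewrite andbA.
by case/andP=> _ vI; rewrite -exprS (cardsD1 v) vI.
Qed.

(** Telescoping: [Z(S - us) / Z(S)] is the product of the ratios obtained by
    deleting the vertices of [us] one at a time. *)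
Lemma Zsub_chain t S us a b : 0 <= a -> 0 <= b ->
  (forall s1 u s2, us = s1 ++ u :: s2 ->
     b * Zsub t (S :\: [set:: s1])%SET <= Zsub t (S :\: [set:: s1] :\ u)%SET
       <= a * Zsub t (S :\: [set:: s1])%SET) ->
  b ^+ size us * Zsub t S <= Zsub t (S :\: [set:: us])%SET
    <= a ^+ size us * Zsub t S.
Proof.
move=> a0 b0; elim/last_ind: us => [|us u IH] H.
  by rewrite finset.set_nil finset.setD0 !expr0 !mul1r !lexx.
have /andP[IH1 IH2] : b ^+ size us * Zsub t S <= Zsub t (S :\: [set:: us])%SET
    <= a ^+ size us * Zsub t S.
  by apply: IH => s1 w s2 E; apply: (H _ _ (rcons s2 u)); rewrite E rcons_cat.
have /andP[H1 H2] := H us u [::] (esym (cats1 _ _)).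
have -> : S :\: [set:: rcons us u]%SET = (S :\: [set:: us] :\ u)%SET.
  by apply/finset.setP => w; rewrite !inE mem_rcons inE negb_or andbA.
rewrite size_rcons !exprS -!mulrA; apply/andP; split.
  exact: le_trans (ler_wpM2l b0 IH1) H1.
exact: le_trans H2 (ler_wpM2l a0 IH2).
Qed.

End SubsetPartition.

(** * The cavity recursion *)

Section Cavity.
Variables (R : realType) (d : nat) (t : R).
Hypothesis t0 : 0 <= t.

Definition cavity_map (x : R) : R := (1 + t * x ^+ d)^-1.

(** [cavity_map] is antitone, so each bound is the image of the opposite one. *)
Fixpoint cavity_bounds k : R * R :=
  if k is k'.+1 then
    let: (lo, hi) := cavity_bounds k' in (cavity_map hi, cavity_map lo)
  else (0, 1).

Definition lower k := (cavity_bounds k).1.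
Definition upper k := (cavity_bounds k).2.

Lemma lowerS k : lower k.+1 = cavity_map (upper k).
Proof. by rewrite /lower /upper /=; case: cavity_bounds. Qed.

Lemma upperS k : upper k.+1 = cavity_map (lower k).
Proof. by rewrite /lower /upper /=; case: cavity_bounds. Qed.

Lemma cavity_den_gt0 x : 0 <= x -> 0 < 1 + t * x ^+ d.
Proof. by move=> x0; rewrite ltr_pwDl // mulr_ge0 // exprn_ge0. Qed.

Lemma cavity_map_gt0 x : 0 <= x -> 0 < cavity_map x.
Proof. by move=> x0; rewrite invr_gt0 cavity_den_gt0. Qed.

Lemma cavity_map_le1 x : 0 <= x -> cavity_map x <= 1.
Proof.
move=> x0; rewrite invf_le1 ?cavity_den_gt0 //.
by rewrite lerDl mulr_ge0 // exprn_ge0.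
Qed.

Lemma bounds_itv k : (0 <= lower k <= 1) && (0 <= upper k <= 1).
Proof.
elim: k => [|k /andP[/andP[l0 _] /andP[u0 _]]].
  by rewrite /lower /upper /= !lexx ler01.
by rewrite lowerS upperS !cavity_map_le1 // !(ltW (cavity_map_gt0 _)).
Qed.

Lemma lower_ge0 k : 0 <= lower k. Proof. by case/andP: (bounds_itv k) => /andP[]. Qed.
Lemma upper_ge0 k : 0 <= upper k. Proof. by case/andP: (bounds_itv k) => _ /andP[]. Qed.
Lemma upper_le1 k : upper k <= 1. Proof. by case/andP: (bounds_itv k) => _ /andP[]. Qed.

Variables (G : sgraph) (g : nat).
Hypothesis regG : regular d.+1 G.
Hypothesis girG : (g%:R%:E <= girth R G)%E.

Lemma card_nbrs (v : G) : #|nbrs v| = d.+1.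
Proof. by rewrite -(regG v); apply: eq_card => w; rewrite !inE. Qed.

(** The vertex [p] is the parent of [v]: it has already been deleted, and the
    hypothesis on walks says that nothing else has been deleted within distance
    [k] of [v] away from [p].  Deleting [v] and then its remaining neighbours
    [us] in turn makes [v] the parent of each of them.  The deletions of [v] and
    of the earlier neighbours preserve the invariant, since a walk from a child
    reaching one of them would extend to a closed nonbacktracking walk of at
    most [k + 3] vertices. *)
Lemma cavity_marginal k (S : {set G}) (p v : G) :
  (k + 3 <= g)%N -> adj p v -> p \notin S ->
  (forall s, (size s <= k)%N -> nonbacktracking p v s -> last v s \in S) ->
  lower k * Zsub t S <= Zsub t (S :\ v)%SET <= upper k * Zsub t S.
Proof.
elim: k S p v => [|k IH] S p v kg apv pS walkS.
  rewrite /lower /upper /= mul0r mul1r (le_trans ler01 (Zsub_ge1 _ t0)) /=.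
  exact: Zsub_mono (finset.subsetDl _ _).
have vS : v \in S by apply: (walkS [::]) => //=; rewrite apv.
pose us := enum (nbrs v :\ p)%SET.
have us_size : size us = d.
  rewrite -cardE; have := card_nbrs v.
  by rewrite (cardsD1 p) inE adj_sym apv => -[].
have us_adj u : u \in us -> (u != p) && adj v u.
  by rewrite mem_enum !inE.
have us_uniq : uniq us by exact: enum_uniq.
have DE : (S :\ v :\: nbrs v = S :\ v :\: [set:: us])%SET.
  apply/finset.setP => w; rewrite !inE mem_enum !inE.
  by case: (eqVneq w p) => [->|//]; rewrite (negbTE pS) !andbF.
have /andP[lo hi] : lower k ^+ d * Zsub t (S :\ v)%SET
    <= Zsub t (S :\ v :\: nbrs v)%SET <= upper k ^+ d * Zsub t (S :\ v)%SET.
  rewrite DE -us_size; apply: Zsub_chain; [exact: upper_ge0|exact: lower_ge0|].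
  move=> s1 u s2 usE.
  have uus : u \in us by rewrite usE mem_cat inE eqxx orbT.
  have /andP[up avu] := us_adj u uus.
  apply: (IH _ v) => //; first by apply: leq_trans kg; rewrite addSn.
    by rewrite !inE eqxx !andbF.
  move=> s ssz nb.
  have kg2 : ((size s).+3 <= g)%N.
    apply: leq_trans kg; rewrite addSn addnS ltnS addn2 !ltnS.
    by apply: leq_trans ssz _.
  have lS : last u s \in S.
    by apply: (walkS (u :: s)) => //=; rewrite apv up.
  have uv : uniq (v :: u :: s).
    by apply: (nonbacktracking_uniq girG nb); apply: ltnW.
  have lv : last u s != v.
    by apply/eqP => E; move: uv; rewrite cons_uniq -E mem_last.
  rewrite !inE lS lv !andbT; apply/negP => ms1.
  set m := last u s in ms1.
  have mus : m \in us by rewrite usE mem_cat ms1.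
  have /andP[_ avm] := us_adj m mus.
  have mu : u != m.
    apply/eqP => E; move: us_uniq; rewrite usE cat_uniq => /and3P[_ /hasPn/(_ u)].
    by rewrite inE eqxx E ms1 => /(_ isT).
  (* Prefixed with [m, v], the walk would return to its starting point [m]. *)
  have nb2 : nonbacktracking m v (u :: s) by rewrite /= adj_sym avm mu.
  have := nonbacktracking_uniq girG nb2 kg2.
  by rewrite cons_uniq inE negb_or mem_last andbF.
have Z1 : 0 < Zsub t (S :\ v)%SET := lt_le_trans ltr01 (Zsub_ge1 _ t0).
rewrite lowerS upperS (Zsub_rec t vS) /cavity_map.
rewrite ler_pdivrMl ?cavity_den_gt0 ?upper_ge0 //.
rewrite ler_pdivlMl ?cavity_den_gt0 ?lower_ge0 //.
by rewrite !mulrDl !mul1r -!mulrA !lerD2l !ler_wpM2l.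
Qed.

(** A vertex of the whole graph has no parent, so that all its [d.+1] neighbours
    are children. *)
Lemma root_marginal k (v : G) : (k + 3 <= g)%N ->
  lower k ^+ d.+1 * Zsub t ([set: G] :\ v)%SET
    <= Zsub t ([set: G] :\ v :\: nbrs v)%SET
    <= upper k ^+ d.+1 * Zsub t ([set: G] :\ v)%SET.
Proof.
move=> kg; pose us := enum (nbrs v).
have DE : ([set: G] :\ v :\: nbrs v = [set: G] :\ v :\: [set:: us])%SET.
  by apply/finset.setP => w; rewrite !inE mem_enum !inE.
have us_size : size us = d.+1 by rewrite -cardE card_nbrs.
have us_adj u : u \in us -> adj v u by rewrite mem_enum !inE.
have us_uniq : uniq us by exact: enum_uniq.
rewrite DE -us_size; apply: Zsub_chain; [exact: upper_ge0|exact: lower_ge0|].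
move=> s1 u s2 usE.
have avu : adj v u by apply: us_adj; rewrite usE mem_cat inE eqxx orbT.
apply: (@cavity_marginal _ _ v) => //; first by rewrite !inE eqxx !andbF.
move=> s ssz nb.
have kg2 : ((size s).+3 <= g)%N.
  by apply: leq_trans kg; rewrite addn3 !ltnS.
have uv : uniq (v :: u :: s).
  by apply: (nonbacktracking_uniq girG nb); apply: ltnW.
have lv : last u s != v.
  by apply/eqP => E; move: uv; rewrite cons_uniq -E mem_last.
rewrite !inE lv !andbT; apply/negP => ms1.
set m := last u s in ms1.
have avm : adj v m by apply: us_adj; rewrite usE mem_cat ms1.
have mu : u != m.
  apply/eqP => E; move: us_uniq; rewrite usE cat_uniq => /and3P[_ /hasPn/(_ u)].
  by rewrite inE eqxx E ms1 => /(_ isT).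
have nb2 : nonbacktracking m v (u :: s) by rewrite /= adj_sym avm mu.
have := nonbacktracking_uniq girG nb2 kg2.
by rewrite cons_uniq inE negb_or mem_last andbF.
Qed.

End Cavity.

(** * Contraction below the critical fugacity *)

Section Calculus.
Variable R : realType.
Implicit Types (a b x y t : R).

Lemma nondecreasing_is_derive (h dh : R -> R) a b : a <= b ->
  (forall y, a <= y <= b -> is_derive y 1 h (dh y)) ->
  (forall y, a <= y <= b -> 0 <= dh y) -> h a <= h b.
Proof.
move=> ab dhP dh0; rewrite -subr_ge0.
have [||c cab ->] := @MVT_segment _ h dh _ _ ab.
- by move=> y /itvP yab; apply: dhP; rewrite !yab.
- apply: derivable_within_continuous => y; rewrite in_itv /= => yab.
  by have := dhP y yab; case.
by rewrite mulr_ge0 ?subr_ge0 //; apply: dh0; move: cab; rewrite in_itv.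
Qed.

(** This is the arithmetic-geometric mean inequality for [d] copies of [y] and
    one of [d.+1%:R - d%:R * y].  The induction step amounts to
    [0 <= (y ^+ d.+1 - 1) * (y - 1)]. *)
Lemma weighted_AMGM d y : 0 <= y -> y ^+ d * (d.+1%:R - d%:R * y) <= 1.
Proof.
move=> y0; elim: d => [|d IH]; first by rewrite expr0 mul0r subr0 mulr1.
suff : 0 <= (y ^+ d.+1 - 1) * (y - 1).
  have := ler_wpM2l y0 IH; rewrite exprS -!natr1; nra.
have [y1|y1] := leP 1 y.
  by rewrite mulr_ge0 ?subr_ge0 ?exprn_ege1.
by rewrite nmulr_lge0 ?subr_lt0 // subr_le0 exprn_ile1 // ltW.
Qed.

(** The right-hand side is the inverse of the critical fugacity for [d]
    children; it is attained at [y = d.-1 / d], the fixed point at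
    criticality, and rescaling by it reduces to [weighted_AMGM]. *)
Lemma critical_slope d y : (2 <= d)%N -> 0 <= y ->
  y ^+ d * (d%:R ^+ 2 * (1 - y) - 1) <= d.-1%:R ^+ d.+1 / d%:R ^+ d.
Proof.
case: d => [|[|e]] // _ y0; set d := e.+2.
have d0 : 0 < d%:R :> R by rewrite ltr0n.
have e0 : 0 < e.+1%:R :> R by rewrite ltr0n.
have dE : d%:R = e.+1%:R + 1 :> R by rewrite natr1.
pose z : R := d%:R / e.+1%:R * y.
have z0 : 0 <= z by rewrite mulr_ge0 // divr_ge0 // ltW.
have yE : y = e.+1%:R / d%:R * z.
  by rewrite /z; field; rewrite !gt_eqF.
have := weighted_AMGM d z0; rewrite -[d.+1%:R]natr1 => am.
rewrite [X in X ^+ d]yE exprMn expr_div_n.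
have -> : d%:R ^+ 2 * (1 - y) - 1 = e.+1%:R * (d%:R + 1 - d%:R * z).
  have gen (D E : R) : D = E + 1 -> D != 0 ->
      D ^+ 2 * (1 - E / D * z) - 1 = E * (D + 1 - D * z).
    by move=> -> h; field.
  by rewrite yE; apply: gen => //; rewrite gt_eqF.
have c0 : 0 <= e.+1%:R ^+ d.+1 / d%:R ^+ d :> R.
  by rewrite divr_ge0 // exprn_ge0 // ltW.
have := ler_wpM2l c0 am; rewrite mulr1.
rewrite (_ : d.-1 = e.+1) //; apply: le_trans; rewrite exprSr le_eqVlt; apply/orP; left.
by apply/eqP; ring.
Qed.

Section Contraction.
Variables (d : nat) (lam kap : R).
(* [kap] measures the distance to criticality, see [subcritical_slope]. *)
Hypothesis kap1 : kap < 1.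
Hypothesis slope : forall y, 0 <= y <= 1 ->
  lam * (y ^+ d.+1 * (d.+1%:R ^+ 2 * (1 - y) - 1)) <= kap.
Hypothesis lam0 : 0 <= lam.
Hypothesis kap0 : 0 <= kap.

Definition rate : R := (kap + lam) / (1 + lam).

Lemma rate_ge0 : 0 <= rate.
Proof. by rewrite divr_ge0 ?addr_ge0. Qed.

Lemma rate_lt1 : rate < 1.
Proof.
have l1 : 0 < 1 + lam by rewrite ltr_pwDl.
by rewrite ltr_pdivrMr // mul1r ltrD2r.
Qed.

Variable t : R.
Hypothesis t_itv : 0 <= t <= lam.
Let t0 : 0 <= t. Proof. by case/andP: t_itv. Qed.
Let tl : t <= lam. Proof. by case/andP: t_itv. Qed.
Local Notation f := (cavity_map d.+1 t).

(** With [s = t * y ^+ d.+1] the hypothesis on slopes gives the bound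
    [(kap + s) / (1 + s)], which increases with [s <= lam].  Hence a single
    [rate] serves all fugacities up to [lam]. *)
Lemma two_step_slope y : 0 <= y <= 1 ->
  d.+1%:R ^+ 2 * (1 - y) * (1 - f y) <= rate.
Proof.
move=> /andP[y0 y1]; set s := t * y ^+ d.+1.
have s0 : 0 <= s by rewrite mulr_ge0 // exprn_ge0.
have s1 : 0 < 1 + s by rewrite ltr_pwDl.
have -> : 1 - f y = s / (1 + s) by rewrite /cavity_map -/s; field; rewrite gt_eqF.
rewrite mulrA ler_pdivrMr // /rate [leRHS]mulrAC ler_pdivlMr ?ltr_pwDl //.
have sl : s <= lam.
  by rewrite -[leRHS]mulr1 ler_pM // ?exprn_ge0 // exprn_ile1.
have h1 : d.+1%:R ^+ 2 * (1 - y) * s <= kap + s.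
  set A := d.+1%:R ^+ 2 * (1 - y).
  have := @slope y; rewrite y0 y1 => /(_ isT); rewrite -/A => sA.
  have [A1|A1] := leP 1 A.
    have : t * (y ^+ d.+1 * (A - 1)) <= lam * (y ^+ d.+1 * (A - 1)).
      by rewrite ler_wpM2r // mulr_ge0 ?exprn_ge0 // subr_ge0.
    by rewrite mulrA -/s; nra.
  by apply: (@le_trans _ _ s); [rewrite ler_piMl // ltW | rewrite lerDr].
have h2 := ler_wpM2r (addr_ge0 ler01 lam0) h1.
have : 0 <= (1 - kap) * (lam - s) by rewrite mulr_ge0 ?subr_ge0 // ltW.
lra.
Qed.

Lemma cavity_den_derive x :
  is_derive x 1 (fun z : R => 1 + t * z ^+ d.+1) (t * (d.+1%:R * x ^+ d)).
Proof.
rewrite (_ : (fun z => _) = horner (1 + t *: 'X^(d.+1))); last first.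
  by apply/funext => z; rewrite hornerD hornerZ hornerXn hornerC.
apply: is_derive_eq.
by rewrite derivD derivC add0r derivZ derivXn hornerZ hornerMn hornerXn mulr_natl.
Qed.

Lemma cavity_map_derive x : 0 < x ->
  is_derive x 1 f (f x * (- (d.+1%:R * (1 - f x)) / x)).
Proof.
move=> x0.
have den : 0 < 1 + t * x ^+ d.+1 by rewrite cavity_den_gt0 // ltW.
have dnz : 1 + t * x ^+ d.+1 != 0 by rewrite gt_eqF.
have df := @is_deriveV R (fun z => 1 + t * z ^+ d.+1) x _ 1 dnz (cavity_den_derive x).
rewrite -[f]/(fun y => (1 + t * y ^+ d.+1)^-1).
apply: is_derive_eq; rewrite /GRing.scale /= /cavity_map exprS in den dnz *; field.
by rewrite !gt_eqF.
Qed.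

Lemma cavity_map_ln_derive x : 0 < x -> is_derive x 1 (fun z => ln (f z))
  (- (d.+1%:R * (1 - f x)) / x).
Proof.
move=> x0.
have dln : is_derive (f x) 1 (@ln R) (f x)^-1.
  by apply: is_derive1_ln; apply: cavity_map_gt0 => //; exact: ltW.
have df := is_derive1_comp dln (cavity_map_derive x0).
apply: is_derive_eq.
by rewrite mulKf // gt_eqF // cavity_map_gt0 // ltW.
Qed.

(** One step of the map need not contract in the coordinate [ln x]: its slope
    is [d (1 - f x)].  Two steps multiply this slope at [x] by the slope at
    [f x], and the product is [two_step_slope] at [y = f x]. *)
Lemma two_step_contraction a b : 0 < a -> a <= b ->
  ln (f (f b)) - ln (f (f a)) <= rate * (ln b - ln a).
Proof.
move=> a0 ab.
suff : rate * ln a - ln (f (f a)) <= rate * ln b - ln (f (f b)) by lra.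
pose dh x := rate * x^-1
   - (- (d.+1%:R * (1 - f (f x))) / f x * (f x * (- (d.+1%:R * (1 - f x)) / x))).
apply: (@nondecreasing_is_derive (fun z => rate * ln z - ln (f (f z))) dh) => //.
  move=> x /andP[ax _]; have x0 : 0 < x := lt_le_trans a0 ax.
  have fx0 : 0 < f x by apply: cavity_map_gt0 => //; exact: ltW.
  have d2 := is_derive1_comp (cavity_map_ln_derive fx0) (cavity_map_derive x0).
  have dl := is_derive1_ln x0.
  exact: is_deriveB (is_deriveZ rate dl) d2.
move=> x /andP[ax _]; have x0 : 0 < x := lt_le_trans a0 ax.
have fx0 : 0 < f x by apply: cavity_map_gt0 => //; exact: ltW.
have fx1 : f x <= 1 by apply: cavity_map_le1 => //; exact: ltW.
have := @two_step_slope (f x); rewrite fx1 ltW // => /(_ isT) sl.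
have -> : dh x = (rate - d.+1%:R ^+ 2 * (1 - f x) * (1 - f (f x))) / x.
  rewrite /dh; field; by rewrite !gt_eqF.
by rewrite divr_ge0 ?subr_ge0 // ltW.
Qed.

Lemma cavity_map_anti x y : 0 <= x -> x <= y -> f y <= f x.
Proof.
move=> x0 xy; have y0 := le_trans x0 xy.
rewrite lef_pV2 ?posrE ?cavity_den_gt0 //.
by rewrite lerD2l ler_wpM2l // lerXn2r.
Qed.

Lemma lower_le_upper k : lower d.+1 t k <= upper d.+1 t k.
Proof.
elim: k => [|k IH]; first by rewrite /lower /upper /= ler01.
by rewrite lowerS upperS cavity_map_anti // lower_ge0.
Qed.

Lemma fixpoint_between k x : 0 <= x <= 1 -> x = f x ->
  lower d.+1 t k <= x <= upper d.+1 t k.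
Proof.
move=> x01 xE; elim: k => [|k /andP[lx xu]]; first by [].
have x0 : 0 <= x by case/andP: x01.
by rewrite lowerS upperS {1 2}xE !cavity_map_anti // lower_ge0.
Qed.

(** Only odd indices are considered because [lower 0 = 0] has no logarithm and
    the contraction takes two steps; at index 1 the logarithmic gap is
    [ln (1 + t) <= lam].  Below 1, a gap is at most its logarithmic gap. *)
Lemma cavity_gap j :
  upper d.+1 t (j.*2.+1) - lower d.+1 t (j.*2.+1) <= lam * rate ^+ j.
Proof.
have lo_gt0 m : 0 < lower d.+1 t m.+1.
  by rewrite lowerS cavity_map_gt0 // upper_ge0.
have : ln (upper d.+1 t j.*2.+1) - ln (lower d.+1 t j.*2.+1) <= lam * rate ^+ j.
  elim: j => [|j IH].
    rewrite expr0 mulr1 lowerS upperS /lower /upper /=.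
    rewrite /cavity_map expr0n /= mulr0 addr0 expr1n mulr1 invr1 ln1.
    rewrite lnV ?posrE ?ltr_pwDl // opprK add0r.
    by apply: le_trans tl; apply: le_ln1Dx; apply: lt_le_trans t0; rewrite ltrN10.
  have -> : upper d.+1 t j.+1.*2.+1 = f (f (upper d.+1 t j.*2.+1)).
    by rewrite doubleS upperS lowerS.
  have -> : lower d.+1 t j.+1.*2.+1 = f (f (lower d.+1 t j.*2.+1)).
    by rewrite doubleS lowerS upperS.
  apply: le_trans (two_step_contraction (lo_gt0 _) (lower_le_upper _)) _.
  by rewrite exprS mulrCA ler_wpM2l // rate_ge0.
apply: le_trans; set k := j.*2.+1.
have l0 : 0 < lower d.+1 t k := lo_gt0 j.*2.
have u0 : 0 < upper d.+1 t k := lt_le_trans l0 (lower_le_upper k).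
have := @le_ln1Dx _ (lower d.+1 t k / upper d.+1 t k - 1).
rewrite ltrBrDl subrr divr_gt0 // => /(_ isT).
rewrite addrC subrK ln_div ?posrE // => h.
have u1 := upper_le1 d.+1 t0 k.
have : (upper d.+1 t k - lower d.+1 t k) <= (1 - lower d.+1 t k / upper d.+1 t k).
  have -> : 1 - lower d.+1 t k / upper d.+1 t k
     = (upper d.+1 t k - lower d.+1 t k) / upper d.+1 t k.
    by field; rewrite gt_eqF.
  by rewrite ler_peMr ?subr_ge0 ?lower_le_upper // invf_ge1.
by lra.
Qed.

End Contraction.
End Calculus.

(** * The derivative of the free energy *)

Section Derivative.
Variables (R : realType) (G : sgraph).

(** Each independent set [I] contributes [#|I|] times [t ^+ #|I|.-1], once for
    each of its vertices. *)
Lemma partition_function_derive (t : R) :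
  is_derive t 1 (fun s => partition_function s G)
    (\sum_(v : G) Zsub t ([set: G] :\ v :\: nbrs v)%SET).
Proof.
pose P : {poly R} := \sum_(I in indep_sets G) 'X^#|I|.
have PE : horner P = (fun s => partition_function s G).
  by apply/funext => s; rewrite horner_sum; apply: eq_bigr => I _; rewrite hornerXn.
rewrite -PE; apply: is_derive_eq.
have -> : P^`() = \sum_(I in indep_sets G) 'X^(#|I|.-1) *+ #|I|.
  by rewrite /P linear_sum; apply: eq_bigr => I _; exact: derivXn.
rewrite horner_sum.
under eq_bigr => I _ do rewrite hornerMn hornerXn -sumr_const.
rewrite (exchange_big_dep xpredT) //=; apply: eq_bigr => v _.
rewrite -sum_indep_mem ?inE //; apply: eq_bigl => I.
by rewrite finset.subsetT.
Qed.

End Derivative.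

Section LogDerivative.
Variables (R : realType) (d : nat) (t : R) (G : sgraph) (g k : nat) (x : R).
Hypothesis t0 : 0 <= t.
Hypothesis regG : regular d.+1 G.
Hypothesis girG : (g%:R%:E <= girth R G)%E.
Hypothesis kg : (k + 3 <= g)%N.
Hypothesis xlu : lower d t k <= x <= upper d t k.

Lemma sub_exprn_le (a b : R) n : 0 <= a -> a <= b -> b <= 1 ->
  b ^+ n - a ^+ n <= n%:R * (b - a).
Proof.
move=> a0 ab b1; elim: n => [|n IH]; first by rewrite !expr0 subrr mul0r.
have b0 := le_trans a0 ab.
have an1 : a ^+ n <= 1 by rewrite exprn_ile1 // (le_trans ab).
have an0 : 0 <= a ^+ n by rewrite exprn_ge0.
have h : a ^+ n <= b ^+ n by rewrite lerXn2r.
rewrite !exprS -natr1; nra.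
Qed.

(** On the infinite tree the ratio [Z(G - N[v]) / Z(G - v)] is [x ^+ d.+1], and
    the function [q |-> q / (1 + t * q)] is 1-Lipschitz. *)
Lemma log_derivative_close :
  `| (\sum_(v : G) Zsub t ([set: G] :\ v :\: nbrs v)%SET) / partition_function t G
     - #|G|%:R * (x ^+ d.+1 / (1 + t * x ^+ d.+1)) |
  <= #|G|%:R * (d.+1%:R * (upper d t k - lower d t k)).
Proof.
set phi := x ^+ d.+1 / _; set ep := _ * (upper d t k - _).
rewrite mulr_suml -sum1_card natr_sum !mulr_suml -sumrB.
apply: le_trans (ler_norm_sum _ _ _) _; apply: ler_sum => v _; rewrite !mul1r.
set Q := Zsub _ _.
have /andP[lx xu] := xlu.
have l0 := lower_ge0 d t0 k.
have x0 := le_trans l0 lx.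
set q := x ^+ d.+1 in phi *; have q0 : 0 <= q by rewrite exprn_ge0.
have /andP[lo hi] := root_marginal t0 regG girG v kg.
rewrite -/Q in lo hi.
set Z1 := Zsub _ _ in lo hi.
have Z10 : 0 < Z1 := lt_le_trans ltr01 (Zsub_ge1 _ t0).
have Q0 : 0 < Q := lt_le_trans ltr01 (Zsub_ge1 _ t0).
have -> : partition_function t G = Z1 + t * Q.
  by rewrite -ZsubT (Zsub_rec t (v := v)) // inE.
have D0 : 0 < Z1 + t * Q by rewrite ltr_pwDl // mulr_ge0 // ltW.
have D1 : 0 < 1 + t * q by rewrite ltr_pwDl // mulr_ge0.
have lq : lower d t k ^+ d.+1 <= q by rewrite lerXn2r ?nnegrE.
have uq : q <= upper d t k ^+ d.+1 by rewrite lerXn2r ?nnegrE // (le_trans x0).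
have epE : upper d t k ^+ d.+1 - lower d t k ^+ d.+1 <= ep.
  by apply: sub_exprn_le => //; [exact: le_trans xu|exact: upper_le1].
have -> : Q / (Z1 + t * Q) - phi = (Q - q * Z1) / ((Z1 + t * Q) * (1 + t * q)).
  by rewrite /phi; field; rewrite !gt_eqF.
rewrite normrM normfV (gtr0_norm (mulr_gt0 D0 D1)) ler_pdivrMr ?mulr_gt0 //.
have ep0 : 0 <= ep.
  by apply: le_trans epE; rewrite subr_ge0 (le_trans lq).
have num : `|Q - q * Z1| <= ep * Z1.
  have : ep * Z1 >= (upper d t k ^+ d.+1 - lower d t k ^+ d.+1) * Z1.
    by rewrite ler_wpM2r // ltW.
  have := ler_wpM2r (ltW Z10) lq; have := ler_wpM2r (ltW Z10) uq.
  by rewrite ler_norml; lra.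
apply: le_trans num _; rewrite ler_wpM2l //.
have h1 : 0 <= t * Q by rewrite mulr_ge0 // ltW.
have h2 : 0 <= t * q by rewrite mulr_ge0.
nra.
Qed.

End LogDerivative.

(** * Integration along the fixed-point curve *)

Section Deviation.
Variables (R : realType) (d : nat) (lam kap : R).
Hypothesis kap1 : kap < 1.
Hypothesis slope : forall y : R, 0 <= y <= 1 ->
  lam * (y ^+ d.+1 * (d.+1%:R ^+ 2 * (1 - y) - 1)) <= kap.
Hypothesis lam0 : 0 <= lam.
Hypothesis kap0 : 0 <= kap.

(** The fugacity at which [y] is the fixed point of the cavity map. *)
Definition fugacity (y : R) : R := (1 - y) / y ^+ d.+2.

Lemma fugacity_fixpoint (y : R) : 0 < y -> y = cavity_map d.+1 (fugacity y) y.
Proof.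
move=> y0; rewrite /cavity_map /fugacity exprS; field.
have yn : 0 < y ^+ d.+1 by rewrite exprn_gt0.
by rewrite addrC subrK oner_eq0 !gt_eqF.
Qed.

Lemma fugacity_anti (y z : R) : 0 < y -> y <= z -> z <= 1 -> fugacity z <= fugacity y.
Proof.
move=> y0 yz z1; have z0 := lt_le_trans y0 yz.
rewrite ler_pM ?subr_ge0 ?invr_ge0 ?exprn_ge0 ?(ltW z0) ?lerB //.
by rewrite lef_pV2 ?posrE ?exprn_gt0 // lerXn2r // nnegrE ltW.
Qed.

(** Derivatives computed on functions built by the ring operations transfer to
    their explicit pointwise forms. *)
Lemma is_derive_ext (f h : R -> R) (y df dh : R) :
  is_derive y 1 f df -> f =1 h -> df = dh -> is_derive y 1 h dh.
Proof. by move=> fP /funext <- <-. Qed.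

Lemma constB_derive (c y : R) : is_derive y 1 (fun z : R => c - z) (-1).
Proof.
have h := is_deriveB (is_derive_cst (c : R^o) (y : R^o) (1 : R^o)) (is_derive_id (y : R^o) 1).
by rewrite sub0r in h.
Qed.

Lemma fugacity_derive (y : R) : 0 < y ->
  is_derive y 1 fugacity (- (y + d.+2%:R * (1 - y)) / y ^+ d.+3).
Proof.
move=> y0; have yn0 : y ^+ d.+2 != 0 by rewrite gt_eqF // exprn_gt0.
have d1 := constB_derive 1 y.
have d2 : is_derive y 1 (fun z : R => z ^+ d.+2) (d.+2%:R * y ^+ d.+1).
  apply: (is_derive_ext (is_derive_poly 'X^(d.+2) y)).
    by move=> z; rewrite hornerXn.
  by rewrite derivXn hornerMn hornerXn mulr_natl.
have d3 := @is_deriveV R (fun z => z ^+ d.+2) y _ 1 yn0 d2.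
apply: (is_derive_ext (is_deriveM d1 d3)) => //.
rewrite /GRing.scale /= [y ^+ d.+3]exprS [y ^+ d.+2]exprS in yn0 *; field.
by rewrite !gt_eqF // exprn_gt0.
Qed.

Definition log_growth (y : R) : R :=
  - (d.+2%:R / 2) * ln y - d%:R / 2 * ln (2 - y).

Lemma log_growth_constE (y : R) : 0 < y -> y <= 1 -> ln (growth_const d.+2 y) = log_growth y.
Proof.
move=> y0 y1; have y2 : 0 < 2 - y by lra.
rewrite /growth_const lnM ?posrE ?powR_gt0 // !ln_powR /log_growth.
by rewrite mulNr (_ : d.+2%:R - 2 = d%:R :> R) ?mulNr // -[d.+2]addn2 natrD addrK.
Qed.

(** The first factor is the derivative of [fugacity], the second one the value
    on the infinite tree of the logarithmic derivative in
    [log_derivative_close]. *)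
Lemma log_growth_derive (y : R) : 0 < y -> y <= 1 ->
  is_derive y 1 log_growth
    (- (y + d.+2%:R * (1 - y)) / y ^+ d.+3 * (y ^+ d.+2 / (1 + fugacity y * y ^+ d.+2))).
Proof.
move=> y0 y1; have y2 : 0 < 2 - y by lra.
have d1 := constB_derive 2 y.
have d2 := @is_derive1_comp R (@ln R) (fun z => 2 - z) y _ _ (is_derive1_ln y2) d1.
have d3 := is_deriveB (is_deriveZ (- (d.+2%:R / 2)) (is_derive1_ln y0))
                      (is_deriveZ (d%:R / 2) d2).
apply: (is_derive_ext d3) => //.
rewrite /GRing.scale /= /fugacity mulfVK; last by rewrite gt_eqF // exprn_gt0.
rewrite (_ : 1 + (1 - y) = 2 - y); last by ring.
rewrite [y ^+ d.+3]exprS -addn2 natrD; field.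
by rewrite !gt_eqF // exprn_gt0.
Qed.

Variables (G : sgraph) (g j : nat).
Hypothesis regG : regular d.+2 G.
Hypothesis girG : (g%:R%:E <= girth R G)%E.
Hypothesis jg : (j.*2.+1 + 3 <= g)%N.
Hypothesis G0 : (0 < #|G|)%N.

(** [H] is the difference of the two free energies at fugacity [fugacity y].
    Its derivative is [e y * dT y], where [e] is the error in the logarithmic
    derivative and [dT <= 0] the derivative of [fugacity]; as [`|e| <= eps],
    both [H - eps * fugacity] and [- H - eps * fugacity] are nondecreasing up
    to [y = 1], where they vanish. *)
Lemma free_energy_deviation x : 0 < x -> x <= 1 -> fugacity x = lam ->
  `| ln (partition_function lam G) / #|G|%:R - ln (growth_const d.+2 x) |
    <= d.+2%:R * (lam * rate lam kap ^+ j) * lam.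
Proof.
move=> x0 x1 xlam; set eps := d.+2%:R * _.
have n0 : 0 < #|G|%:R :> R by rewrite ltr0n.
pose Z s := partition_function s G : R.
pose dZ s := \sum_(v : G) Zsub s ([set: G] :\ v :\: nbrs v)%SET : R.
pose phi y : R := y ^+ d.+2 / (1 + fugacity y * y ^+ d.+2).
pose dT y : R := - (y + d.+2%:R * (1 - y)) / y ^+ d.+3.
pose H y := #|G|%:R^-1 * ln (Z (fugacity y)) - log_growth y.
pose e y := #|G|%:R^-1 * (dZ (fugacity y) / Z (fugacity y)) - phi y.
have pos y : x <= y <= 1 -> 0 < y by case/andP=> xy _; exact: lt_le_trans xy.
have fug y : x <= y <= 1 -> 0 <= fugacity y <= lam.
  move=> xy; have y0 := pos y xy; case/andP: xy => xy y1.
  rewrite -xlam fugacity_anti // andbT divr_ge0 ?subr_ge0 //.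
  by rewrite exprn_ge0 // ltW.
have dH y : x <= y <= 1 -> is_derive y 1 H (e y * dT y).
  move=> xy; have y0 := pos y xy; have y1 : y <= 1 by case/andP: xy.
  have /andP[t0 _] := fug y xy.
  have Z0 : 0 < Z (fugacity y) by rewrite /Z -ZsubT (lt_le_trans ltr01) ?Zsub_ge1.
  have h1 := is_derive1_comp (partition_function_derive G (fugacity y)) (fugacity_derive y0).
  have h2 := is_derive1_comp (is_derive1_ln Z0 :
    is_derive (((fun s => partition_function s G) \o fugacity) y) 1 (@ln R) _) h1.
  have h3 := is_deriveB (is_deriveZ #|G|%:R^-1 h2) (log_growth_derive y0 y1).
  apply: (is_derive_ext h3) => //.
  rewrite /GRing.scale /= /e /dT /phi -/(dZ _) -/(Z _) mulrBl; congr (_ - _).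
    by rewrite -!mulrA; congr (_ * _); rewrite mulrCA mulrA.
  by rewrite mulrC.
have ebound y : x <= y <= 1 -> `|e y| <= eps.
  move=> xy; have y0 := pos y xy; have y1 : y <= 1 by case/andP: xy.
  have tl := fug y xy; have t0 : 0 <= fugacity y by case/andP: tl.
  have y01 : 0 <= y <= 1 by rewrite ltW.
  have btw := fixpoint_between tl j.*2.+1 y01 (fugacity_fixpoint y0).
  have := log_derivative_close t0 regG girG jg btw.
  rewrite -/(dZ _) -/(Z _) -/(phi _) => h.
  have -> : e y = #|G|%:R^-1 * (dZ (fugacity y) / Z (fugacity y) - #|G|%:R * phi y).
    by rewrite mulrBr mulKf // gt_eqF.
  rewrite normrM normfV (gtr0_norm n0) ler_pdivrMl //; apply: le_trans h _.
  rewrite ler_wpM2l ?(ltW n0) // ler_wpM2l //.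
  exact: (cavity_gap kap1 slope lam0 kap0 tl).
have dT0 y : x <= y <= 1 -> dT y <= 0.
  move=> xy; have y0 := pos y xy; have y1 : y <= 1 by case/andP: xy.
  by rewrite /dT mulNr oppr_le0 divr_ge0 ?exprn_ge0 ?addr_ge0 ?mulr_ge0 ?subr_ge0 // ltW.
have H1 : H 1 = 0.
  rewrite /H /log_growth /fugacity subrr mul0r ln1 mulr0 sub0r.
  rewrite (_ : 2 - 1 = 1 :> R); last by ring.
  rewrite ln1 mulr0 oppr0 subr0 /Z /partition_function (bigD1 finset.set0) ?indep0 //=.
  rewrite cards0 expr0 big1 ?addr0 ?ln1 ?mulr0 // => I /andP[_ I0].
  by rewrite expr0n cards_eq0 (negbTE I0).
have T1 : fugacity 1 = 0 by rewrite /fugacity subrr mul0r.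
have -> : ln (partition_function lam G) / #|G|%:R - ln (growth_const d.+2 x) = H x.
  by rewrite /H log_growth_constE // xlam mulrC.
have up : H x - eps * fugacity x <= H 1 - eps * fugacity 1.
  apply: (@nondecreasing_is_derive _ (fun y => H y - eps * fugacity y)
            (fun y => e y * dT y - eps * dT y)) => // y xy.
    exact: is_deriveB (dH y xy) (is_deriveZ eps (fugacity_derive (pos y xy))).
  have := ebound y xy; rewrite ler_norml => /andP[_ h].
  by rewrite -mulrBl mulr_le0 ?subr_le0 // dT0.
have dn : - H x - eps * fugacity x <= - H 1 - eps * fugacity 1.
  apply: (@nondecreasing_is_derive _ (fun y => - H y - eps * fugacity y)
            (fun y => - (e y * dT y) - eps * dT y)) => // y xy.
    exact: is_deriveB (is_deriveN (dH y xy)) (is_deriveZ eps (fugacity_derive (pos y xy))).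
  have := ebound y xy; rewrite ler_norml => /andP[h _].
  by rewrite -mulNr -mulrBl mulr_le0 ?dT0 // subr_le0; lra.
by move: up dn; rewrite H1 T1 xlam ler_norml; lra.
Qed.

End Deviation.

(** * Regular graphs of large girth *)

Section HighGirth.
Variables (r g : nat).

Definition reduced (w : seq 'I_r) : bool :=
  sorted (fun i j => i != j) w.

Local Notation words := (g.+1.-bseq 'I_r).

(** Adds or removes the letter [i] in front of [w].  Keeping nonreduced words
    fixed, and full words that cannot be extended, makes this an involution on
    all bounded words, so that no subtype of reduced words is needed. *)
Definition toggle_seq (i : 'I_r) (w : seq 'I_r) : seq 'I_r :=
  if reduced w then
    if w is j :: w' then
      if i == j then w' else if (size w <= g)%N then i :: w else w
    else [:: i]
  else w.

Lemma size_toggle_seq i w : (size w <= g.+1)%N -> (size (toggle_seq i w) <= g.+1)%N.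
Proof.
rewrite /toggle_seq; case: ifP => // _; case: w => [|j w] //= sw.
by case: ifP => _; [exact: ltnW|case: ifP].
Qed.

Definition toggle (i : 'I_r) (w : words) : words := Bseq (size_toggle_seq i (size_bseq w)).

Lemma toggleK i : involutive (toggle i).
Proof.
move=> w; apply: val_inj => /=; have := size_bseq w; case: w => /= w _.
rewrite /toggle_seq; case rw : (reduced w); last by rewrite rw.
case: w rw => [|j w] /=; first by rewrite eqxx.
rewrite /reduced /= => pw sw; case: (eqVneq i j) => [->|ij].
  rewrite (path_sorted pw); case: w pw sw => [|k w] //= /andP[/negbTE -> _] sw.
  by rewrite -ltnS sw.
case: (ltnP (size w) g) => sg /=; first by rewrite ij pw eqxx.
by rewrite pw (negbTE ij) ltnNge sg.
Qed.

Definition toggle_perm i : {perm words} := perm (can_inj (toggleK i)).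

Lemma toggle_permK i : (toggle_perm i * toggle_perm i)%g = 1%g.
Proof. by apply/permP => w; rewrite permM !permE /= toggleK. Qed.

Definition nil_word : words := @Bseq g.+1 'I_r [::] isT.

Definition cayley_adj (p q : {perm words}) : bool :=
  [exists i, q == p * toggle_perm i]%g.

Lemma cayley_sym : symmetric cayley_adj.
Proof.
move=> p q; apply/existsP/existsP => -[i /eqP->]; exists i;
  by rewrite -mulgA toggle_permK mulg1.
Qed.

Lemma toggle_perm_inj : injective toggle_perm.
Proof.
move=> i j /permP/(_ nil_word); rewrite !permE.
by move/(congr1 val) => /= -[].
Qed.

Lemma cayley_irr : irreflexive cayley_adj.
Proof.
move=> p; apply/negbTE/existsP => -[i]; rewrite -{1}[p]mulg1 => /eqP/mulgI.
move/permP/(_ nil_word); rewrite perm1 permE.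
by move/(congr1 val).
Qed.

Definition cayley_graph := SGraph cayley_sym cayley_irr.

Lemma cayley_regular : regular r cayley_graph.
Proof.
move=> p.
have injf : injective (fun i => p * toggle_perm i)%g by move=> i j /mulgI/toggle_perm_inj.
rewrite -[RHS](card_ord r) -(card_imset _ injf); apply: eq_card => q.
by rewrite !inE; apply/existsP/imsetP => [[i /eqP->]|[i _ ->]]; exists i.
Qed.

(** Follow the image of one word [x0] along the walk: right multiplication by
    a generator toggles a letter in front of this image, and the absence of
    backtracking prevents the letter just added from being removed, so the
    image grows by one letter at each step. *)
Lemma cayley_walk (x0 : words) (i : 'I_r) (p q : cayley_graph) (s : seq cayley_graph) :
  nonbacktracking p q s -> (q = p * toggle_perm i)%g ->
  q x0 = i :: p x0 :> seq 'I_r -> reduced (q x0) ->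
  (size (q x0) + size s <= g.+1)%N ->
  size (last q s x0) = (size (q x0) + size s)%N.
Proof.
elim: s i p q => [|z s IH] i p q /=; first by rewrite addn0.
move=> /andP[_ /andP[zp nb]] qE qx rq sg.
have [j zE] : exists j, z = (q * toggle_perm j)%g.
  by case: s nb {IH sg} => [|? ?] /andP[/existsP[j /eqP->] _]; exists j.
have ji : j != i.
  by apply: contraNneq zp => ji; rewrite zE qE ji -mulgA toggle_permK mulg1.
have zx : z x0 = j :: q x0 :> seq 'I_r.
  rewrite zE permM permE /= /toggle_seq rq qx (negbTE ji) -qx.
  by rewrite (leq_trans _ (_ : size (q x0) + size s <= g)%N) ?leq_addr // -ltnS -addnS.
rewrite (IH j q z nb zE zx); first by rewrite zx /= addSnnS.
  by rewrite zx qx /reduced /= ji; move: rq; rewrite qx.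
by rewrite zx /= addSnnS.
Qed.

Lemma uniq_nonbacktracking (G : sgraph) (x y : G) s :
  path (@adj G) x (y :: s) -> uniq (x :: y :: s) -> nonbacktracking x y s.
Proof.
elim: s x y => [|z s IH] x y /=; first by rewrite !andbT => ->.
move=> /and3P[-> ayz ps] /and3P[xyz yz uz]; apply/andP; split => //.
apply/andP; split.
  by apply: contraNneq xyz => ->; rewrite !inE eqxx orbT.
by apply: IH; rewrite /= ?ayz ?ps //= yz.
Qed.

(** Choose the word [x0] whose image under the first vertex of the cycle is
    empty.  Before the closing edge its image has at least two letters, and one
    toggle cannot bring it back to the empty word. *)
Lemma cayley_girth (R : realType) : (g%:R%:E <= girth R cayley_graph)%E.
Proof.
apply: le_ereal_inf_tmp => _ [c [sc /andP[cc uc]] <-].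
rewrite lee_fin ler_nat leqNgt; apply/negP => cg.
case: c sc cc uc cg => [|p [|q s]] // sc cc uc cg.
have pq : path (@adj cayley_graph) p (q :: s).
  by move: cc => /= /andP[-> ]; rewrite rcons_path => /andP[].
have nb := uniq_nonbacktracking pq uc.
have [i qE] : exists i, q = (p * toggle_perm i)%g.
  by case/andP: pq => /existsP[i /eqP->] _; exists i.
pose x0 : words := (p^-1)%g nil_word.
have px : p x0 = [::] :> seq 'I_r by rewrite /x0 permKV.
have qx : q x0 = [:: i] :> seq 'I_r by rewrite qE permM permE /= px.
have sl : size (last q s x0) = (size s).+1.
  have := @cayley_walk x0 i p q s nb qE.
  rewrite qx px => -> //=; by rewrite add1n ltnW // ltnW // ltnW.
have [j pE] : exists j, p = (last q s * toggle_perm j)%g.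
  move: cc; rewrite /= rcons_path => /and3P[_ _ /existsP[j /eqP E]].
  by exists j.
move: (px); rewrite pE permM permE => /= E.
move: sl; rewrite /toggle_seq in E; move: E; case: ifP => _.
  by case: (last q s x0) => -[|a w] //= _; case: ifP => _; [move=> -> /= [] |case: ifP];
   case: (s) sc.
by move=> ->.
Qed.

End HighGirth.

(** * The fixed point of the cavity map *)

Section FixedPoint.
Variable R : realType.
Implicit Types (lam x y : R).

Lemma pos_fixpointE r lam x : 0 < lam ->
  pos_fixpoint r lam x <-> 0 < x /\ x + lam * x ^+ r.-1.+1 = 1.
Proof.
move=> l0; split=> -[x0 E]; split=> //.
  have D0 : 1 + lam * x ^+ r.-1 != 0.
    by rewrite gt_eqF // addr_gt0 // mulr_gt0 // exprn_gt0.
  have : x * (1 + lam * x ^+ r.-1) = 1 by rewrite {1}E mulfVK.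
  by rewrite exprS => <-; ring.
have D0 : 1 + lam * x ^+ r.-1 != 0.
  by rewrite gt_eqF // addr_gt0 // mulr_gt0 // exprn_gt0.
apply: (mulIf D0); rewrite mulfVK // -[RHS]E exprS; ring.
Qed.

Lemma fixpoint_lt n lam x y : 0 < lam -> 0 <= x -> x < y ->
  x + lam * x ^+ n < y + lam * y ^+ n.
Proof.
move=> l0 x0 xy; rewrite ltr_leD // ler_pM2l // lerXn2r ?nnegrE ?(ltW xy) //.
by rewrite (le_trans x0) // ltW.
Qed.

Lemma pos_fixpoint_uniq r lam x y : 0 < lam ->
  pos_fixpoint r lam x -> pos_fixpoint r lam y -> x = y.
Proof.
move=> l0 /(pos_fixpointE _ _ l0)[x0 Ex] /(pos_fixpointE _ _ l0)[y0 Ey].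
apply/eqP; case: ltgtP => // xy.
  by have := fixpoint_lt r.-1.+1 l0 (ltW x0) xy; rewrite Ex Ey ltxx.
by have := fixpoint_lt r.-1.+1 l0 (ltW y0) xy; rewrite Ex Ey ltxx.
Qed.

(** Intermediate value theorem for [x + lam * x ^+ r] between 0 and 1. *)
Lemma pos_fixpoint_exists r lam : 0 < lam -> exists x, pos_fixpoint r lam x.
Proof.
move=> l0; pose p : {poly R} := 'X + lam *: 'X^(r.-1.+1).
have pE z : p.[z] = z + lam * z ^+ r.-1.+1.
  by rewrite hornerD hornerX hornerZ hornerXn.
have cont : {within `[0, 1], continuous (horner p)}.
  by apply: continuous_subspaceT; exact: continuous_horner.
have p01 : Num.min p.[0] p.[1] <= 1 <= Num.max p.[0] p.[1].
  rewrite !pE expr0n mulr0 addr0 expr1n mulr1 ge_min ler01 le_max.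
  by rewrite [1 <= 1 + lam]lerDl (ltW l0) orbT.
have [x] := IVT ler01 cont p01.
rewrite in_itv /= pE => /andP[x0 _] E; exists x; apply/(pos_fixpointE r x l0).
split=> //; rewrite lt_neqAle x0 andbT; apply/eqP => xz.
by move/eqP: E; rewrite -xz expr0n mulr0 addr0 eq_sym oner_eq0.
Qed.

Lemma pos_fixpoint_fugacity d lam x : 0 < lam -> pos_fixpoint d.+2 lam x ->
  [/\ 0 < x, x <= 1 & fugacity d x = lam].
Proof.
move=> l0 /(pos_fixpointE _ _ l0)[x0 /= E]; split => //.
  by rewrite -E lerDl mulr_ge0 ?exprn_ge0 // ltW.
by rewrite /fugacity -[X in X - x]E addrAC subrr add0r mulfK // gt_eqF // exprn_gt0.
Qed.

(** The number [kap] is [lam] divided by the critical fugacity.  For a graph of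
    degree 2 the latter is infinite, and [kap = 0] is correct. *)
Lemma subcritical_slope d lam : 0 < lam -> (lam%:E < lambda_crit R d.+2)%E ->
  exists kap, [/\ 0 <= kap, kap < 1 & forall y, 0 <= y <= 1 ->
    lam * (y ^+ d.+1 * (d.+1%:R ^+ 2 * (1 - y) - 1)) <= kap].
Proof.
move=> l0; case: d => [_|d].
  exists 0; split=> // y /andP[y0 y1].
  have : 0 <= lam * y ^+ 2 by rewrite mulr_ge0 ?sqr_ge0 // ltW.
  rewrite expr1; lra.
rewrite /lambda_crit /= lte_fin => lc.
have d0 : 0 < d.+1%:R ^+ d.+3 :> R by rewrite exprn_gt0 // ltr0n.
have e0 : 0 < d.+2%:R ^+ d.+2 :> R by rewrite exprn_gt0 // ltr0n.
exists (lam * (d.+1%:R ^+ d.+3 / d.+2%:R ^+ d.+2)); split.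
- by rewrite mulr_ge0 ?divr_ge0 // ltW.
- by rewrite mulrA ltr_pdivrMr // mul1r -ltr_pdivlMr.
move=> y /andP[y0 _]; rewrite ler_pM2l //.
exact: (@critical_slope _ d.+2 y).
Qed.

End FixedPoint.

(** * Convergence of the free energy *)

Section Convergence.
Variable R : realType.

(** The terms may be infinite at first, so convergence includes their being
    eventually finite. *)
Lemma ereal_cvg0 (s : nat -> \bar R) :
  (forall e : R, 0 < e -> exists N, forall g, (N <= g)%N -> (0 <= s g <= e%:E)%E) ->
  s g @[g --> \oo] --> 0%:E.
Proof.
move=> H; have fin g (e : R) : (0 <= s g <= e%:E)%E -> s g \is a fin_num.
  by case/andP=> s0 se; rewrite ge0_fin_numE // (le_lt_trans se) ?ltry.
apply/fine_cvgP; split.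
  have [N HN] := H 1 ltr01; exists N => // g Ng; exact: fin (HN g Ng).
apply/cvgrPdist_le => e e0; have [N HN] := H e e0.
exists N => // g Ng /=; have sg := HN g Ng; have /andP[s0 se] := sg.
rewrite sub0r normrN ger0_norm ?fine_ge0 //.
by rewrite -lee_fin fineK // (fin _ e).
Qed.

(** The Cayley graph is what makes the supremum nonnegative. *)
Lemma sup_deviation_cvg d (lam x : R) : 0 < lam ->
  (lam%:E < lambda_crit R d.+2)%E -> pos_fixpoint d.+2 lam x ->
  sup_deviation (fun G => ln (partition_function lam G))
    (ln (growth_const d.+2 x)) g d.+2 @[g --> \oo] --> 0%:E.
Proof.
move=> l0 lc fx; have [kap [kap0 kap1 slope]] := subcritical_slope l0 lc.
have [x0 x1 xl] := pos_fixpoint_fugacity l0 fx.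
set rho := rate lam kap.
have rho0 : 0 <= rho := rate_ge0 (ltW l0) kap0.
have rho1 : rho < 1 := rate_lt1 kap1 (ltW l0).
apply: ereal_cvg0 => e e0.
have [j Hj] : exists j, d.+2%:R * (lam * rho ^+ j) * lam <= e.
  have /cvgrPdist_le/(_ _ e0) : geometric (d.+2%:R * lam * lam) rho @ \oo --> (0 : R).
    by apply: cvg_geometric; rewrite ger0_norm.
  case=> N _ /(_ N (leqnn N)) /=; rewrite sub0r normrN => h; exists N.
  apply: le_trans h; apply: le_trans (ler_norm _).
  by rewrite le_eqVlt; apply/orP; left; apply/eqP; ring.
exists (j.*2.+1 + 3)%N => g jg; apply/andP; split.
  pose G := cayley_graph d.+2 g.
  apply: (@le_trans _ _
    `| ln (partition_function lam G) / #|G|%:R - ln (growth_const d.+2 x) |%:E).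
    by rewrite lee_fin.
  apply: ereal_sup_ubound; exists #|G|, G.
  split=> //; first by apply/card_gt0P; exists (1%g : {perm _}).
  by split=> //; [exact: cayley_regular|exact: cayley_girth].
apply: ge_ereal_sup => _ [n [G [n1 [Gn regG girG] ->]]].
rewrite lee_fin -Gn; apply: le_trans Hj.
apply: (free_energy_deviation kap1 slope (ltW l0) kap0 regG girG jg) => //.
by rewrite Gn.
Qed.

End Convergence.

(** * Numerical values of the growth constant *)

Section Numerics.
Variable R : realType.

Lemma growth_const_gt0 r (x : R) : 0 < x -> x <= 1 -> 0 < growth_const r x.
Proof. by move=> x0 x1; rewrite mulr_gt0 // powR_gt0 //; lra. Qed.

Lemma growth_const_sqr d (x : R) : 0 < x -> x <= 1 ->
  growth_const d.+2 x ^+ 2 * (x ^+ d.+2 * (2 - x) ^+ d) = 1.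
Proof.
move=> x0 x1; have y0 : 0 < 2 - x by lra.
have half (a : R) n : 0 < a -> (a `^ (- (n%:R / 2))) ^+ 2 = (a ^+ n)^-1.
  move=> a0; rewrite powRN exprVn; congr _^-1.
  have h : (n%:R / 2 + n%:R / 2 == 0 :> R) ==> (a != 0) by rewrite (gt_eqF a0) implybT.
  by rewrite expr2 -(powRD h) -splitr powR_mulrn // ltW.
rewrite /growth_const exprMn (half x) //.
rewrite (_ : d.+2%:R - 2 = d%:R :> R); last by rewrite -addn2 natrD addrK.
rewrite (half (2 - x)) //; field.
by rewrite !gt_eqF // exprn_gt0.
Qed.

(** The inequalities on [a] and [b] enclose the fixed point, since
    [x + x ^+ d.+2] is increasing.  Squaring the growth constant turns its half-integer
    powers into the monotone products compared here. *)
Lemma growth_const_approx d (x v e a b : R) :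
  pos_fixpoint d.+2 1 x -> 0 < a -> 0 <= e <= v -> 0 < b <= 1 ->
  a + a ^+ d.+2 <= 1 -> 1 <= b + b ^+ d.+2 ->
  (v - e) ^+ 2 * (b ^+ d.+2 * (2 - a) ^+ d) <= 1 ->
  1 <= (v + e) ^+ 2 * (a ^+ d.+2 * (2 - b) ^+ d) ->
  `| growth_const d.+2 x - v | <= e.
Proof.
move=> fx a0 /andP[e0 ev] /andP[b0 b1] ha hb lo hi.
have [x0 x1 _] := pos_fixpoint_fugacity ltr01 fx.
have [_ E] := (pos_fixpointE _ _ ltr01).1 fx; rewrite mul1r /= in E.
have ax : a <= x.
  rewrite leNgt; apply/negP => xa.
  by have := fixpoint_lt d.+2 ltr01 (ltW x0) xa; rewrite !mul1r E ltNge ha.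
have xb : x <= b.
  rewrite leNgt; apply/negP => bx.
  by have := fixpoint_lt d.+2 ltr01 (ltW b0) bx; rewrite !mul1r E ltNge hb.
have c0 := growth_const_gt0 d.+2 x0 x1.
have cE := growth_const_sqr d x0 x1.
set c := growth_const _ _ in c0 cE *; set W := x ^+ _ * _ in cE.
have Wlo : a ^+ d.+2 * (2 - b) ^+ d <= W.
  by rewrite ler_pM ?exprn_ge0 ?lerXn2r ?nnegrE //; lra.
have Whi : W <= b ^+ d.+2 * (2 - a) ^+ d.
  by rewrite ler_pM ?exprn_ge0 ?lerXn2r ?nnegrE //; lra.
have W0 : 0 < W by rewrite mulr_gt0 ?exprn_gt0 //; lra.
have h1 : c <= v + e.
  have ve : 0 <= v + e by lra.
  rewrite -(@ler_pXn2r _ 2) ?nnegrE ?(ltW c0) //.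
  by rewrite -(ler_pM2r W0) cE; apply: le_trans hi _; rewrite ler_wpM2l ?sqr_ge0.
have h2 : v - e <= c.
  rewrite -(@ler_pXn2r _ 2) ?nnegrE ?subr_ge0 ?(ltW c0) //.
  by rewrite -(ler_pM2r W0) cE; apply: le_trans lo; rewrite ler_wpM2l ?sqr_ge0.
by rewrite ler_norml; lra.
Qed.

Lemma growth_const_table (r : nat) (v : R) :
  (r, v) \in [:: (2%N, 1618 / 1000); (3%N, 1545 / 1000);
                 (4%N, 1494 / 1000); (5%N, 1453 / 1000)] ->
  [/\ (2 <= r)%N, (1%:E < lambda_crit R r)%E &
      forall x, pos_fixpoint r 1 x -> `| growth_const r x - v | <= 1 / 1000].
Proof.
rewrite !inE => /orP[|/orP[|/orP[|]]] /eqP[-> ->]; split=> //.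
(* The fractions below enclose the fixed points closely enough for the
   required accuracy while keeping the arithmetic on integers small. *)
- by rewrite ltry.
- by move=> x fx; apply: (growth_const_approx (a := 55 / 89) (b := 34 / 55) fx); lra.
- by rewrite /lambda_crit /= lte_fin; lra.
- by move=> x fx; apply: (growth_const_approx (a := 73 / 107) (b := 58 / 85) fx); lra.
- by rewrite /lambda_crit /= lte_fin; lra.
- by move=> x fx; apply: (growth_const_approx (a := 71 / 98) (b := 50 / 69) fx); lra.
- by rewrite /lambda_crit /= lte_fin; lra.
- by move=> x fx; apply: (growth_const_approx (a := 117 / 155) (b := 77 / 102) fx); lra.
Qed.

End Numerics.

Theorem theorem3 (R : realType) :
  (forall (r : nat) (lam : R),
     (2 <= r)%N -> 0 < lam -> (lam%:E < lambda_crit R r)%E ->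
     (exists! x : R, pos_fixpoint r lam x) /\
     (forall x : R, pos_fixpoint r lam x ->
        sup_deviation (fun G => ln (partition_function lam G))
                      (ln (growth_const r x)) g r @[g --> \oo] --> 0%:E)) /\
  (forall (r : nat) (v : R),
     (r, v) \in [:: (2%N, 1618 / 1000); (3%N, 1545 / 1000);
                    (4%N, 1494 / 1000); (5%N, 1453 / 1000)] ->
     (1%:E < lambda_crit R r)%E /\
     exists2 c : R,
       (forall x : R, pos_fixpoint r 1 x -> c = growth_const r x) &
       [/\ sup_deviation (fun G => ln (#|indep_sets G|%:R : R))
                         (ln c) g r @[g --> \oo] --> 0%:E
         & `|c - v| <= 1 / 1000]).
Proof.
split=> [[|[|d]] // lam _ l0 lc|r v rv].
  split=> [|x]; last exact: sup_deviation_cvg.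
  have [x fx] := pos_fixpoint_exists d.+2 l0.
  by exists x; split=> // y; exact: pos_fixpoint_uniq.
have [r2 lc approx] := growth_const_table rv; split=> //.
have [x fx] := pos_fixpoint_exists r (@ltr01 R).
exists (growth_const r x) => [y fy|].
  by rewrite (pos_fixpoint_uniq ltr01 fx fy).
split; last exact: approx.
have -> : (fun G => ln (#|indep_sets G|%:R : R))
    = (fun G => ln (partition_function 1 G)).
  apply/funext => G; congr ln; rewrite /partition_function.
  by under eq_bigr do rewrite expr1n; rewrite sumr_const.
by case: r r2 lc fx {approx rv} => [|[|d]] // _ lc fx; exact: sup_deviation_cvg.
Qed.
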